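(* For all integers $m,d\ge 0$, the equivariant characteristic polynomial $H_{m,d}(t)=H^{S_{m+d}}_{U_{m,d}}(t)\in\mathrm{grVRep}(S_{m+d})$ of the uniform matroid $U_{m,d}$ of rank $d$ on $m+d$ elements, with its natural action of $S_{m+d}$, is log concave.
   Context: For a finite group $W$, $\mathrm{Rep}(W)$ is the semiring of isomorphism classes of finite-dimensional complex representations of $W$, $\mathrm{VRep}(W)\supset\mathrm{Rep}(W)$ is its Grothendieck ring (virtual representations), and $\mathrm{grVRep}(W)=\mathrm{VRep}(W)\otimes_{\mathbb Z}\mathbb Z[t]$. A sequence $(C_0,C_1,C_2,\ldots)$ in $\mathrm{VRep}(W)$ is log concave if for all $i>0$, $C_i^{\otimes 2}-C_{i-1}\otimes C_{i+1}\in\mathrm{Rep}(W)$. An element of $\mathrm{grVRep}(W)$ is log concave if its sequence of coefficients (of $t^0,t^1,t^2,\ldots$) is log concave. For a matroid $M$ on a finite ground set $\mathcal I$ with a finite group $W$ acting on $\mathcal I$ and preserving $M$, the Orlik-Solomon algebra of $M$ is the quotient of the exterior algebra over $\mathbb C$ on generators $e_i$ ($i\in\mathcal I$) by the ideal generated by $\partial e_C$ for all circuits $C$ of $M$ (where $e_{\{i_1,\dots,i_r\}}=e_{i_1}\wedge\cdots\wedge e_{i_r}$ and $\partial$ is the derivation with $\partial e_i=1$); $W$ acts by permuting the generators, and the degree $p$ part is $OS^W_{M,p}\in\mathrm{Rep}(W)$. The equivariant characteristic polynomial is $H^W_M(t)=\sum_{p=0}^{\operatorname{rk}M}(-1)^p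 t^{\operatorname{rk}M-p}OS^W_{M,p}\in\mathrm{grVRep}(W)$. *)

(* Defs.v *)
From HB Require Import structures.
From mathcomp Require Import all_boot all_order all_algebra all_fingroup.
From mathcomp Require Import mxrepresentation character.
From mathcomp Require Import complex.
From mathcomp Require Import reals.

Set Implicit Arguments.
Unset Strict Implicit.
Unset Printing Implicit Defensive.

Import GRing.Theory.
Local Open Scope ring_scope.

Section VirtualRepresentations.

Variables (F : fieldType) (gT : finGroupType) (W : {group gT}).
Local Notation rep := (representation F W).

Definition prod_grepr (V1 V2 : rep) : rep := Representation (prod_repr V1 V2).

(* The pair (V, V') stands for the formal difference [V] - [V'];  equality in *)
(* the Grothendieck ring is the relation [veq] below, not Leibniz equality.   *)
Record vrep := VRep { vpos : rep; vneg : rep }.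

Definition veq (x y : vrep) : Prop :=
  exists Z : rep,
    mx_rsim (dadd_grepr (dadd_grepr (vpos x) (vneg y)) Z)
            (dadd_grepr (dadd_grepr (vpos y) (vneg x)) Z).

Definition vrep_of (V : rep) : vrep := VRep V grepr0.

Definition vzero : vrep := vrep_of grepr0.

Definition vopp (x : vrep) : vrep := VRep (vneg x) (vpos x).

Definition vadd (x y : vrep) : vrep :=
  VRep (dadd_grepr (vpos x) (vpos y)) (dadd_grepr (vneg x) (vneg y)).

Definition vsub (x y : vrep) : vrep := vadd x (vopp y).

Definition vmul (x y : vrep) : vrep :=
  VRep (dadd_grepr (prod_grepr (vpos x) (vpos y))
                   (prod_grepr (vneg x) (vneg y)))
       (dadd_grepr (prod_grepr (vpos x) (vneg y))
                   (prod_grepr (vneg x) (vpos y))).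

(* (-1)^p x *)
Definition vsign (p : nat) (x : vrep) : vrep := iter p vopp x.

(* Membership in the image of Rep(W) in VRep(W). *)
Definition is_rep (x : vrep) : Prop := exists V : rep, veq x (vrep_of V).

(* VRep(W)[t]: an element is the list of its coefficients, constant one first. *)
Definition grvrep := seq vrep.

Definition coefv (f : grvrep) (i : nat) : vrep := nth vzero f i.

Definition log_concave_seq (C : nat -> vrep) : Prop :=
  forall i : nat, (0 < i)%N ->
    is_rep (vsub (vmul (C i) (C i)) (vmul (C i.-1) (C i.+1))).

Definition log_concave (f : grvrep) : Prop := log_concave_seq (coefv f).

End VirtualRepresentations.

Record matroid (I : finType) := Matroid {
  indep : {set {set I}};
  indep0 : set0 \in indep;
  indepS : forall A B : {set I}, A \subset B -> B \in indep -> A \in indep;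
  indep_exchange : forall A B : {set I}, A \in indep -> B \in indep ->
    (#|A| < #|B|)%N -> exists2 x, x \in B :\: A & x |: A \in indep
}.

Definition circuit (I : finType) (M : matroid I) (C : {set I}) : bool :=
  minset [pred A | A \notin indep M] C.

Definition mrank (I : finType) (M : matroid I) : nat :=
  \max_(A in indep M) #|A|.

Section Uniform.

Variables m d : nat.
Implicit Types A B : {set 'I_(m + d)}.

Definition uniform_indep : {set {set 'I_(m + d)}} := 
  [set A : {set 'I_(m + d)} | (#|A| <= d)%N].

Lemma uniform_indep0 : set0 \in uniform_indep.
Proof. by rewrite inE cards0. Qed.

Lemma uniform_indepS A B :
  A \subset B -> B \in uniform_indep -> A \in uniform_indep.
Proof. by move=> sAB; rewrite !inE; apply: leq_trans (subset_leq_card sAB). Qed.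

Lemma uniform_exchange A B : A \in uniform_indep -> B \in uniform_indep ->
  (#|A| < #|B|)%N -> exists2 x, x \in B :\: A & x |: A \in uniform_indep.
Proof.
rewrite !inE => _ leBd ltAB.
have /set0Pn[x BDx] : B :\: A != set0.
  by apply: contraL ltAB; rewrite setD_eq0 -leqNgt => /subset_leq_card.
exists x => //; rewrite inE cardsU1.
by case/setDP: BDx => _ -> /=; apply: leq_trans leBd.
Qed.

Definition uniform : matroid 'I_(m + d) :=
  Matroid uniform_indep0 uniform_indepS uniform_exchange.

Lemma mrank_uniform : mrank uniform = d.
Proof.
apply/eqP; rewrite eqn_leq; apply/andP; split.
  by apply/bigmax_leqP=> A; rewrite inE.
have cA : #|[set @rshift m d i | i : 'I_d]| = d.
  by rewrite card_imset ?card_ord //; apply: rshift_inj.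
by apply: (bigmax_sup [set @rshift m d i | i : 'I_d]); rewrite ?inE ?cA.
Qed.

Lemma uniform_acts :
  {acts [set: 'S_(m + d)], on indep uniform | ('P)^*}.
Proof.
by move=> s _ A; rewrite !inE /= card_imset //; apply: act_inj.
Qed.

End Uniform.

(* The exterior algebra on generators e_i (i in I) has basis e_A = e_{i_1} /\ *)
(* ... /\ e_{i_r}, for A = {i_1 < ... < i_r} a subset of I, where I is        *)
(* ordered by [enum_rank]. Elements are row vectors indexed by subsets of I.  *)
Section Exterior.

Variables (F : fieldType) (I : finType).
Implicit Types (A B C : {set I}) (a b : I).

Local Notation ext := 'rV[F]_#|{set I}|.
Implicit Types x y z : ext.

Definition ltI a b : bool := (enum_rank a < enum_rank b)%N.

Definition ebase A : ext := delta_mx 0 (enum_rank A).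

Definition ecoef A x : F := x 0 (enum_rank A).

(* (-1)^k, where k is the number of inversions in A followed by B; thus       *)
(* e_A /\ e_B = esign A B *: e_(A :|: B) when A and B are disjoint.           *)
Definition esign A B : F := \prod_(a in A) \prod_(b in B) (-1) ^+ ltI b a.

Definition emulb A B : ext :=
  if [disjoint A & B] then esign A B *: ebase (A :|: B) else 0.

Definition emul x y : ext :=
  \sum_A \sum_B (ecoef A x * ecoef B y) *: emulb A B.

(* [esign [set a] (A :\ a)] is (-1)^(k-1) if a is the k-th element of A.      *)
Definition ederivb A : ext :=
  \sum_(a in A) esign [set a] (A :\ a) *: ebase (A :\ a).

Definition ederiv x : ext := \sum_A ecoef A x *: ederivb A.

Definition edegree (p : nat) : 'M[F]_#|{set I}| :=
  (\sum_(A : {set I} | #|A| == p) <<ebase A>>)%MS.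

Lemma ecoefE A B : ecoef B (ebase A) = (A == B)%:R.
Proof. by rewrite /ecoef mxE eqxx (inj_eq enum_rank_inj) eq_sym. Qed.

Lemma ext_basis x : x = \sum_A ecoef A x *: ebase A.
Proof.
rewrite {1}[x]row_sum_delta (reindex _ (onW_bij _ (@enum_rank_bij {set I}))) /=.
exact: eq_bigr.
Qed.

Lemma ecoef_is_linear A : scalar (ecoef A).
Proof. by move=> k x y; rewrite /ecoef !mxE. Qed.
HB.instance Definition _ A :=
  GRing.isSemilinear.Build F ext F _ (ecoef A)
    (GRing.semilinear_linear (@ecoef_is_linear A)).

Lemma emul_is_linear x : linear (emul x).
Proof.
move=> k y z; rewrite /emul scaler_sumr -big_split; apply: eq_bigr => A _ /=.
rewrite scaler_sumr -big_split; apply: eq_bigr => B _ /=.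
by rewrite (linearP (ecoef B)) /= scalerA -scalerDl mulrDr mulrCA.
Qed.
HB.instance Definition _ x :=
  GRing.isSemilinear.Build F ext ext _ (emul x)
    (GRing.semilinear_linear (@emul_is_linear x)).

Definition emulr y x := emul x y.

Lemma emulr_is_linear y : linear (emulr y).
Proof.
move=> k x z; rewrite /emulr /emul scaler_sumr -big_split.
apply: eq_bigr => A _ /=.
rewrite scaler_sumr -big_split; apply: eq_bigr => B _ /=.
by rewrite (linearP (ecoef A)) /= scalerA -scalerDl mulrDl mulrA.
Qed.
HB.instance Definition _ y :=
  GRing.isSemilinear.Build F ext ext _ (emulr y)
    (GRing.semilinear_linear (@emulr_is_linear y)).

Lemma emulZl k x y : emul (k *: x) y = k *: emul x y.
Proof. exact: (linearZZ (emulr y)). Qed.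

Lemma emulZr k x y : emul x (k *: y) = k *: emul x y.
Proof. exact: (linearZZ (emul x)). Qed.

Lemma ederiv_is_linear : linear ederiv.
Proof.
move=> k x y; rewrite /ederiv scaler_sumr -big_split; apply: eq_bigr => A _ /=.
by rewrite (linearP (ecoef A)) /= scalerDl scalerA.
Qed.
HB.instance Definition _ :=
  GRing.isSemilinear.Build F ext ext _ ederiv
    (GRing.semilinear_linear ederiv_is_linear).

Lemma ext_linear_ext (V : lmodType F) (f g : {linear ext -> V}) :
  (forall A, f (ebase A) = g (ebase A)) -> f =1 g.
Proof.
move=> fg x; rewrite (ext_basis x) !linear_sum.
by apply: eq_bigr => A _; rewrite !linearZ fg.
Qed.

Lemma emul_base A B : emul (ebase A) (ebase B) = emulb A B.
Proof.
rewrite /emul (bigD1 A) //= (bigD1 B) //= !ecoefE !eqxx mulr1 scale1r.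
rewrite big1 => [|C nBC]; last first.
  by rewrite !ecoefE [B == _]eq_sym (negPf nBC) mulr0 scale0r.
rewrite addr0 big1 ?addr0 // => C nAC.
by rewrite big1 // => D _; rewrite !ecoefE [A == _]eq_sym (negPf nAC) mul0r scale0r.
Qed.

Lemma ederiv_base A : ederiv (ebase A) = ederivb A.
Proof.
rewrite /ederiv (bigD1 A) //= ecoefE eqxx scale1r big1 ?addr0 // => B nAB.
by rewrite ecoefE eq_sym (negPf nAB) scale0r.
Qed.


Lemma esign0l B : esign set0 B = 1.
Proof. by rewrite /esign big_set0. Qed.

Lemma esign0r A : esign A set0 = 1.
Proof. by rewrite /esign big1 // => a _; rewrite big_set0. Qed.

Lemma esignUl A B C : [disjoint A & B] ->
  esign (A :|: B) C = esign A C * esign B C.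
Proof.
move=> dAB; rewrite /esign -bigU //=.
by apply: eq_bigl => a; rewrite !inE.
Qed.

Lemma esignUr A B C : [disjoint A & B] ->
  esign C (A :|: B) = esign C A * esign C B.
Proof.
move=> dAB; rewrite /esign -big_split; apply: eq_bigr => c _ /=.
by rewrite -bigU //=; apply: eq_bigl => a; rewrite !inE.
Qed.

Lemma esign_sqr A B : esign A B * esign A B = 1.
Proof.
rewrite /esign -big_split big1 // => a _ /=.
by rewrite -big_split big1 // => b _ /=; rewrite -expr2 sqrr_sign.
Qed.

Lemma esignC A B : [disjoint A & B] ->
  esign A B * esign B A = (-1) ^+ (#|A| * #|B|).
Proof.
move=> dAB; rewrite /esign [X in _ * X]exchange_big /= -big_split /=.
rewrite (eq_bigr (fun=> (-1) ^+ #|B|)) => [|a aA].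
  by rewrite prodr_const -exprM mulnC.
rewrite -big_split (eq_bigr (fun=> -1)) ?prodr_const // => b bB /=.
have: enum_rank a != enum_rank b :> nat.
  rewrite (inj_eq val_inj) (inj_eq enum_rank_inj).
  by apply: contraTneq bB => <-; rewrite (disjointFr dAB).
by rewrite -signr_addb /ltI; case: ltngtP => //; rewrite expr1.
Qed.

Lemma emul1x x : emul (ebase set0) x = x.
Proof.
apply: (@ext_linear_ext ext (emul (ebase set0)) idfun) => A /=.
rewrite emul_base /emulb -setI_eq0 set0I eqxx set0U.
by rewrite esign0l scale1r.
Qed.

Lemma emulx1 x : emul x (ebase set0) = x.
Proof.
apply: (@ext_linear_ext ext (emulr (ebase set0)) idfun) => A /=.
rewrite /emulr emul_base /emulb -setI_eq0 setI0 eqxx setU0.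
by rewrite esign0r scale1r.
Qed.

Lemma emulA x y z : emul x (emul y z) = emul (emul x y) z.
Proof.
apply: (@ext_linear_ext ext (emulr (emul y z)) (emulr z \o emulr y)) => A /=.
rewrite /emulr; apply: (@ext_linear_ext ext
  (emul (ebase A) \o emulr z) (emulr z \o emul (ebase A))) => B /=.
rewrite /emulr; apply: (@ext_linear_ext ext
  (emul (ebase A) \o emul (ebase B)) (emul (emul (ebase A) (ebase B)))) => C /=.
rewrite !emul_base /emulb; case: ifP => dBC; last first.
  rewrite linear0; case: ifP => _; last by rewrite -/(emulr _ _) linear0.
  rewrite -/(emulr _ _) linearZ /= /emulr emul_base /emulb -setI_eq0 setIUl.
  by rewrite setU_eq0 !setI_eq0 dBC andbF scaler0.
rewrite linearZ /= emul_base /emulb -setI_eq0 setIUr setU_eq0 !setI_eq0.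
case dAB: [disjoint A & B] => /=; last first.
  by rewrite scaler0 -/(emulr _ _) linear0.
rewrite -/(emulr _ _) linearZ /= /emulr emul_base /emulb -[in RHS]setI_eq0.
rewrite setIUl setU_eq0 !setI_eq0 dBC andbT; case: ifP => dAC.
  by rewrite !scalerA esignUl // esignUr // setUA mulrC -mulrA.
by rewrite !scaler0.
Qed.

Lemma emul_gen_sqr a : emul (ebase [set a]) (ebase [set a]) = 0.
Proof. by rewrite emul_base /emulb -setI_eq0 setIid -cards_eq0 cards1. Qed.

Lemma emul_gen_anticomm a b :
  emul (ebase [set a]) (ebase [set b]) = - emul (ebase [set b]) (ebase [set a]).
Proof.
have [<-|nab] := eqVneq a b; first by rewrite emul_gen_sqr oppr0.
have dab: [disjoint [set a] & [set b]] by rewrite disjoints1 inE.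
rewrite !emul_base /emulb dab disjoint_sym dab setUC -scaleNr; congr (_ *: _).
apply: (can_inj (mulrK (_ : esign [set b] [set a] \is a GRing.unit))).
  by apply/unitrPr; exists (esign [set b] [set a]); rewrite esign_sqr.
by rewrite esignC // !cards1 mulNr esign_sqr.
Qed.

Lemma ederiv1 : ederiv (ebase set0) = 0.
Proof. by rewrite ederiv_base /ederivb big_set0. Qed.

Lemma ederiv_mul a x :
  ederiv (emul (ebase [set a]) x) = x - emul (ebase [set a]) (ederiv x).
Proof.
apply/esym/eqP; rewrite subr_eq eq_sym; apply/eqP.
apply: (@ext_linear_ext ext ((ederiv \o emul (ebase [set a])) \+
  (emul (ebase [set a]) \o ederiv)) idfun) => A /=.
rewrite emul_base ederiv_base /ederivb linear_sum /= /emulb disjoints1.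
have [aA|aA] /= := boolP (a \in A).
  rewrite linear0 add0r (bigD1 a) //= linearZ /= emul_base /emulb disjoints1.
  rewrite !inE eqxx /= scalerA esign_sqr scale1r setD1K // big1 ?addr0 // => b.
  case/andP=> _ nba; rewrite linearZ /= emul_base /emulb disjoints1 !inE aA.
  by rewrite eq_sym nba scaler0.
rewrite linearZ /= ederiv_base /ederivb big_setU1 //= setU1K // scalerDr.
rewrite scalerA esign_sqr scale1r -addrA scaler_sumr -big_split big1 ?addr0 //.
move=> b bA /=; have nba: b != a by apply: contraNneq aA => <-.
have dab: [disjoint [set a] & [set b]] by rewrite disjoints1 inE eq_sym.
have daA: [disjoint [set a] & A :\ b] by rewrite disjoints1 !inE negb_and aA orbT.
have dbA: [disjoint [set b] & A :\ b] by rewrite disjoints1 !inE eqxx.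
rewrite [X in _ + X]linearZ /= emul_base /emulb daA.
have ->: (a |: A) :\ b = a |: A :\ b.
  by apply/setP=> c; rewrite !inE; case: eqVneq => // ->; rewrite (negPf nba).
rewrite !scalerA -scalerDl -{1}(setD1K bA) (esignUr _ dbA) (esignUr _ daA).
rewrite mulrACA esignC // !cards1 expr1 mulN1r [X in _ + X]mulrC addNr.
by rewrite scale0r.
Qed.

End Exterior.

(* W acts on the generators by e_i |-> e_(to i w), and on the exterior        *)
(* algebra by algebra automorphisms; the matrix acts on row vectors.          *)
Section ExteriorAction.

Variables (F : fieldType) (I : finType) (gT : finGroupType) (W : {group gT}).
Variable to : action W I.
Implicit Types (A B C : {set I}) (a b : I) (g : gT).

Local Notation ext := 'rV[F]_#|{set I}|.
Implicit Types x y : ext.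

(* The sign of the permutation sorting to i_1 g, ..., to i_r g, where         *)
(* A = {i_1 < ... < i_r}.                                                     *)
Definition asign g A : F :=
  \prod_(a in A) \prod_(b in A | ltI a b) (-1) ^+ ltI (to b g) (to a g).

Definition eact g : 'M[F]_#|{set I}| :=
  \matrix_(i < #|{set I}|)
    (asign g (enum_val i) *: ebase F (to^*%act (enum_val i) g)).

Lemma ebase_act A g : ebase F A *m eact g = asign g A *: ebase F (to^*%act A g).
Proof. by rewrite -rowE rowK enum_rankK. Qed.

Lemma ltIC a b : a != b -> ltI b a = ~~ ltI a b.
Proof.
by rewrite -(inj_eq enum_rank_inj) -(inj_eq val_inj) /ltI /=; case: ltngtP.
Qed.

Lemma asign1 A : asign 1%g A = 1.
Proof.
rewrite /asign big1 // => a _; rewrite big1 // => b /andP[_ lab].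
rewrite !act1 ltIC; first by rewrite lab.
by apply: contraTneq lab => ->; rewrite /ltI ltnn.
Qed.

(* -1 if g exchanges the relative order of a and b, and 1 otherwise.          *)
Definition inv_sign g a b : F := (-1) ^+ (ltI a b (+) ltI (to a g) (to b g)).

Lemma act_neq g a b : a != b -> to a g != to b g.
Proof. by apply: contra_neq; apply: act_inj. Qed.

Lemma inv_signC g a b : a != b -> inv_sign g a b = inv_sign g b a.
Proof.
move=> nab; rewrite /inv_sign (ltIC nab) (ltIC (act_neq g nab)).
by rewrite addbN addNb negbK.
Qed.

Lemma inv_signM g h a b : g \in W -> h \in W ->
  inv_sign (g * h)%g a b = inv_sign g a b * inv_sign h (to a g) (to b g).
Proof.
move=> Wg Wh; rewrite /inv_sign !actMin // -signr_addb; congr (_ ^+ _).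
by rewrite addbA -[in RHS](addbA (ltI a b)) addbb addbF.
Qed.

Lemma asignE g A :
  asign g A = \prod_(a in A) \prod_(b in A | ltI a b) inv_sign g a b.
Proof.
apply: eq_bigr => a _; apply: eq_bigr => b /andP[_ lab].
have nab: a != b by apply: contraTneq lab => ->; rewrite /ltI ltnn.
by rewrite /inv_sign lab (ltIC (act_neq g nab)).
Qed.

Lemma prod_sym_rel (t : I -> I -> F) (r : rel I) A :
  (forall a b, a != b -> t a b = t b a) -> irreflexive r ->
  (forall a b, a != b -> r b a = ~~ r a b) ->
  \prod_(a in A) \prod_(b in A | r a b) t a b =
  \prod_(a in A) \prod_(b in A | ltI a b) t a b.
Proof.
move=> tC rI rC.
pose f (r1 r2 : rel I) a b := if r1 a b && r2 a b then t a b else 1.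
pose gtI a b := ltI b a.
have splitP (r1 r2 : rel I) : irreflexive r1 ->
    (forall a b, a != b -> r2 b a = ~~ r2 a b) ->
  \prod_(a in A) \prod_(b in A | r1 a b) t a b =
  (\prod_(a in A) \prod_(b in A) f r1 r2 a b) *
  (\prod_(a in A) \prod_(b in A) f r1 (fun a b => r2 b a) a b).
  move=> r1I r2C; rewrite -big_split; apply: eq_bigr => a _ /=.
  rewrite -big_split big_mkcondr; apply: eq_bigr => b _ /=; rewrite /f.
  have [<-|nab] := eqVneq a b; first by rewrite r1I mulr1.
  rewrite (r2C _ _ nab); case: (r1 a b); case: (r2 a b) => /=;
    by rewrite ?mulr1 ?mul1r.
have ltII : irreflexive (@ltI I) by move=> a; rewrite /ltI ltnn.
rewrite (splitP r (@ltI I) rI (@ltIC)) (splitP (@ltI I) r ltII rC).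
congr (_ * _).
  by apply: eq_bigr => a _; apply: eq_bigr => b _; rewrite /f andbC.
rewrite exchange_big; apply: eq_bigr => b _; apply: eq_bigr => a _ /=.
rewrite /f andbC; have [->//|nab] := eqVneq a b.
by rewrite tC.
Qed.

Lemma asign_sym (r : rel I) g A : irreflexive r ->
  (forall a b, a != b -> r b a = ~~ r a b) ->
  asign g A = \prod_(a in A) \prod_(b in A | r a b) inv_sign g a b.
Proof.
by move=> rI rC; rewrite asignE prod_sym_rel //; apply: inv_signC.
Qed.

Lemma asignM A g h : g \in W -> h \in W ->
  asign (g * h)%g A = asign g A * asign h (to^*%act A g).
Proof.
move=> Wg Wh; have tI : injective (to^~ g) by apply: act_inj.
pose r a b := ltI (to a g) (to b g).
have rI : irreflexive r by move=> a; rewrite /r /ltI ltnn.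
have rC a b : a != b -> r b a = ~~ r a b.
  by move=> nab; apply: ltIC; apply: act_neq.
rewrite [asign g A](asign_sym _ _ rI rC) [asign h _]asignE.
rewrite [asign _ A](asign_sym _ _ rI rC).
rewrite [X in _ * X]big_imset /=; last by move=> ? ? _ _; apply: tI.
rewrite -big_split; apply: eq_bigr => a _ /=.
rewrite [X in _ * X]big_mkcondr /= big_imset /=; last first.
  by move=> ? ? _ _; apply: tI.
rewrite -big_mkcondr -big_split; apply: eq_bigr => b _ /=.
exact: inv_signM.
Qed.

Lemma asignU A B g : [disjoint A & B] ->
  asign g (A :|: B) * esign F A B =
  asign g A * asign g B * esign F (to^*%act A g) (to^*%act B g).
Proof.
move=> dAB; have tI : injective (to^~ g) by apply: act_inj.
have bigUs (f : I -> F) : \prod_(a in A :|: B) f a =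
    (\prod_(a in A) f a) * \prod_(a in B) f a.
  by rewrite -bigU //=; apply: eq_bigl => a; rewrite !inE.
pose f a b := if ltI a b then inv_sign g a b else 1.
have fE C : asign g C = \prod_(a in C) \prod_(b in C) f a b.
  by rewrite asignE; apply: eq_bigr => a _; rewrite big_mkcondr.
rewrite !fE bigUs (eq_bigr _ (fun a _ => bigUs _)) big_split /=.
rewrite [X in _ * X * _](eq_bigr _ (fun a _ => bigUs _)) big_split /=.
rewrite [X in _ * X * _]mulrC mulrACA -[LHS]mulrA; congr (_ * _).
rewrite [X in _ * X * _]exchange_big -!big_split /=.
rewrite /esign [RHS]big_imset /=; last by move=> ? ? _ _; apply: tI.
apply: eq_bigr => a aA; rewrite big_imset /=; last by move=> ? ? _ _; apply: tI.
rewrite -!big_split; apply: eq_bigr => b bB /=.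
have nab: a != b by apply: contraTneq bB => <-; rewrite (disjointFr dAB).
rewrite /f (inv_signC _ nab) (ltIC nab) /inv_sign.
rewrite [ltI b a](ltIC nab) (ltIC (act_neq g nab)).
by case: (ltI a b); case: ltI;
  rewrite /= ?expr0 ?expr1 ?mulr1 ?mul1r ?mulN1r ?opprK.
Qed.

Lemma emulM x y g : emul x y *m eact g = emul (x *m eact g) (y *m eact g).
Proof.
have tI : injective (to^~ g) by apply: act_inj.
apply: (@ext_linear_ext _ _ ext (mulmxr (eact g) \o emulr y)
  (emulr (y *m eact g) \o mulmxr (eact g))) => A /=; rewrite /emulr.
apply: (@ext_linear_ext _ _ ext (mulmxr (eact g) \o emul (ebase F A))
  (emul (ebase F A *m eact g) \o mulmxr (eact g))) => B /=.
rewrite !ebase_act linearZ /= -[emul (_ *: _) _]/(emulr _ _) linearZ /=.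
rewrite /emulr !emul_base /emulb.
rewrite -![[disjoint _ & _]]setI_eq0 -(imsetI (in2W tI)) imset_eq0.
case: eqP => [/eqP|_]; last by rewrite mul0mx !scaler0.
rewrite setI_eq0 => dAB; rewrite -scalemxAl ebase_act !scalerA.
have -> : to^*%act (A :|: B) g = to^*%act A g :|: to^*%act B g by apply: imsetU.
by rewrite mulrC asignU // -mulrA mulrCA mulrA.
Qed.

Lemma ederivM x g : ederiv x *m eact g = ederiv (x *m eact g).
Proof.
have tI : injective (to^~ g) by apply: act_inj.
apply: (@ext_linear_ext _ _ ext (mulmxr (eact g) \o @ederiv F I)
  (@ederiv F I \o mulmxr (eact g))) => A /=.
rewrite ebase_act linearZ /= !ederiv_base /ederivb mulmx_suml scaler_sumr.
rewrite big_imset /=; last by move=> ? ? _ _; apply: tI.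
apply: eq_bigr => a aA; rewrite -scalemxAl ebase_act !scalerA.
have daA: [disjoint [set a] & A :\ a] by rewrite disjoints1 !inE eqxx.
have aE : to^*%act [set a] g = [set to a g] by apply: imset_set1.
have -> : to^*%act A g :\ to a g = to^*%act (A :\ a) g.
  rewrite -{1}(setD1K aA).
  have -> : to^*%act (a |: A :\ a) g = to a g |: to^*%act (A :\ a) g.
    by rewrite -aE; apply: imsetU.
  by rewrite setU1K // (mem_imset _ _ tI) !inE eqxx.
have /(congr1 ( *%R^~ (esign F [set a] (A :\ a)))) := asignU g daA.
have asign_a : asign g [set a] = 1.
  rewrite /asign big_set1 big1 // => b /andP[/set1P-> ].
  by rewrite /ltI ltnn.
rewrite aE asign_a mul1r -mulrA esign_sqr mulr1 setD1K // => ->; congr (_ *: _).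
rewrite mulrAC -(mulrA (asign g _)) esign_sqr mulr1; exact: mulrC.
Qed.

Lemma eact_repr : mx_repr W eact.
Proof.
split=> [|g h Wg Wh]; apply/row_matrixP=> i; rewrite !rowK.
  by rewrite asign1 scale1r act1 row1 /ebase enum_valK.
by rewrite row_mul rowK -scalemxAl ebase_act scalerA asignM // actMin.
Qed.

Definition ext_repr : mx_representation F W #|{set I}| :=
  MxRepresentation eact_repr.

Lemma edegree_module p : mxmodule ext_repr (edegree F I p).
Proof.
apply/mxmoduleP=> g Wg; rewrite sumsmxMr; apply/sumsmx_subP=> A /eqP cA.
rewrite (eqmxMr _ (genmxE _)) /= ebase_act scalemx_sub //.
rewrite (sumsmx_sup (to^*%act A g)) ?genmxE //.
by rewrite card_imset ?cA //; apply: act_inj.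
Qed.

End ExteriorAction.

(* The two-sided ideal of the exterior algebra generated by the ederiv e_C,   *)
(* for C a circuit of M, as the span of the e_A /\ (ederiv e_C) /\ e_B.       *)
Definition os_ideal (F : fieldType) (I : finType) (M : matroid I) :
    'M[F]_#|{set I}| :=
  (\sum_(C : {set I} | circuit M C) \sum_(A : {set I}) \sum_(B : {set I})
     <<emul (emul (ebase F A) (ederiv (ebase F C))) (ebase F B)>>)%MS.

Section OrlikSolomonIdeal.

Variables (F : fieldType) (I : finType) (M : matroid I).
Local Notation ext := 'rV[F]_#|{set I}|.
Implicit Types x y z : ext.

Lemma os_ideal_gen C x y : circuit M C ->
  (emul (emul x (ederiv (ebase F C))) y <= os_ideal F M)%MS.
Proof.
move=> circC; rewrite (ext_basis x) -/(emulr (ederiv _) _) linear_sum /=.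
rewrite -/(emulr y _) linear_sum; apply: summx_sub => A _ /=.
rewrite /emulr !emulZl scalemx_sub // (ext_basis y) linear_sum /=.
apply: summx_sub => B _; rewrite emulZr scalemx_sub //.
rewrite (sumsmx_sup C) // (sumsmx_sup A) // (sumsmx_sup B) //.
by rewrite genmxE.
Qed.

Lemma os_ideal_mul x y z :
  (z <= os_ideal F M)%MS -> (emul (emul x z) y <= os_ideal F M)%MS.
Proof.
have emulE u : emul (emul x u) y = u *m lin1_mx (emulr y \o emul x).
  by rewrite mul_rV_lin1.
rewrite emulE => /submxMr/submx_trans; apply.
rewrite sumsmxMr; apply/sumsmx_subP=> C circC.
rewrite sumsmxMr; apply/sumsmx_subP=> A _.
rewrite sumsmxMr; apply/sumsmx_subP=> B _.
rewrite (eqmxMr _ (genmxE _)) -emulE !emulA -[emul (emul _ (ebase F B)) _]emulA.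
exact: os_ideal_gen.
Qed.

End OrlikSolomonIdeal.

Section OrlikSolomon.

Variables (F : fieldType) (I : finType) (M : matroid I).
Variables (gT : finGroupType) (W : {group gT}) (to : action W I).
Hypothesis actsM : {acts W, on indep M | to^*}.

Lemma circuit_act g C : g \in W -> circuit M C -> circuit M (to^*%act C g).
Proof.
move=> Wg /minsetP[/= nC minC]; apply/minsetP; split=> /= [|B nB sBC].
  by rewrite actsM.
have Wg' : g^-1%g \in W by rewrite groupV.
rewrite -(minC (to^*%act B g^-1%g)) ?actKVin //=; first by rewrite actsM.
by rewrite -[C](actKin (to^*) Wg); apply: imsetS.
Qed.

Lemma os_ideal_module : mxmodule (ext_repr F to) (os_ideal F M).
Proof.
apply/mxmoduleP=> g Wg; rewrite sumsmxMr; apply/sumsmx_subP=> C circC.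
rewrite sumsmxMr; apply/sumsmx_subP=> A _.
rewrite sumsmxMr; apply/sumsmx_subP=> B _.
rewrite (eqmxMr _ (genmxE _)) /= !emulM ederivM !ebase_act.
rewrite [ederiv _]linearZ /= emulZl !emulZr emulZl !scalemx_sub //.
rewrite (sumsmx_sup (to^*%act C g)) ?circuit_act //.
rewrite (sumsmx_sup (to^*%act A g)) // (sumsmx_sup (to^*%act B g)) //.
by rewrite genmxE emulZl scalemx_sub.
Qed.

(* OS^W_{M,p}: the image of the degree p part of the exterior algebra in its  *)
(* quotient by [os_ideal].                                                    *)
Definition os_repr (p : nat) : representation F W :=
  Representation (section_repr os_ideal_module (edegree_module F to p)).

(* The coefficient of t^k is (-1)^(rk M - k) OS^W_{M, rk M - k}, k <= rk M.   *)
Definition equiv_char_poly : grvrep F W :=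
  mkseq (fun k => vsign (mrank M - k) (vrep_of (os_repr (mrank M - k))))
    (mrank M).+1.

End OrlikSolomon.

Definition uniform_char_poly (F : fieldType) (m d : nat) :
    grvrep F [set: 'S_(m + d)] :=
  equiv_char_poly F (@uniform_acts m d).

(* Main.v *)
From HB Require Import structures.
From mathcomp Require Import all_boot all_order all_algebra all_fingroup.
From mathcomp Require Import complex reals.
From mathcomp Require Import pgroup mxrepresentation character.
Require Import Defs.

(* Write L_p for the p-th exterior power of the permutation representation.   *)
(* The circuits of U_{m,d} have d+1 elements, so the Orlik-Solomon ideal      *)
(* starts in degree d: OS_p = L_p for p < d, while every OS_p is a quotient,  *)
(* hence by Maschke a direct summand, of L_p. It therefore suffices to embed  *)
(* L_{p+2} (x) L_p into L_{p+1} (x) L_{p+1}. The map T which contracts the    *)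
(* first factor by e_a, wedges the second one with e_a and sums over a is     *)
(* equivariant; with its adjoint T^* it generates an action of sl_2, and      *)
(* T^* T - T T^* is 2 in bidegree (p+2, p). Hence T v = 0 there implies       *)
(* |T^* v|^2 + 2 |v|^2 = 0, that is v = 0.                                    *)

Set Implicit Arguments.
Unset Strict Implicit.
Unset Printing Implicit Defensive.

Import GRing.Theory Num.Theory.
Local Open Scope ring_scope.

(** Let OS_q be the degree q part of the Orlik-Solomon algebra and L_q the q-th exterior power. The
    coefficients at i - 1 and i + 1 carry the same sign, so with p = d - i - 1 log concavity at 0 <
    i < d says that OS_{p+2} (x) OS_p is contained in OS_{p+1} (x) OS_{p+1}; for i >= d the
    coefficient at i + 1 is 0. By Maschke an equivariant injection suffices ([is_rep_embeds],
    [is_rep_signed]).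

    It is the composite OS_{p+2} (x) OS_p -> L_{p+2} (x) L_p -> L_{p+1} (x) L_{p+1} -> OS_{p+1} (x)
    OS_{p+1}. The first arrow splits a quotient map ([embeds_section]). The last one is the quotient
    map itself, injective because the ideal has no part in degree p + 1 = d - i < d
    ([section_embeds], [edegree_os_ideal]).

    The middle arrow T is [eshift]. With its transpose it satisfies the sl_2 relation
    [eshift_commutator], where the weight of bidegree (q, r) is q - r. The matrix of T is real, so
    its transpose is its Hermitian adjoint, and positivity of the norm makes T injective in weight 2
    ([eshift_free]). *)

(** * Entries and bilinearity of the Kronecker product *)

Section TensorEntries.

(** [tfst] and [tsnd] decode an index of a Kronecker product. Their recursion copies that of [trow]
    and [tprod], so that the entry formulas follow by induction. *)
Fixpoint tfst (m n : nat) : 'I_(m * n) -> 'I_m :=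
  if m is m'.+1 return 'I_(m * n) -> 'I_m then
    fun i => if split (i : 'I_(n + m' * n)) is inr k
             then lift ord0 (tfst k) else ord0
  else id.

Fixpoint tsnd (m n : nat) : 'I_(m * n) -> 'I_n :=
  if m is m'.+1 return 'I_(m * n) -> 'I_n then
    fun i => match split (i : 'I_(n + m' * n)) with
             | inl k => k | inr k => tsnd k end
  else fun i => match notF (ltn_ord i) with end.

Variable F : fieldType.

Lemma trow_entry n1 (A : 'rV[F]_n1) m2 n2 (B : 'M[F]_(m2, n2)) i j :
  trow A B i j = A 0 (tfst j) * B i (tsnd j).
Proof.
elim: n1 A j => [|n1 IH] A j /=; first by case: j.
rewrite mxE; case: (split _) => k; last by rewrite IH mxE rshift1.
by rewrite !mxE lshift0.
Qed.

Lemma tprod_entry m1 n1 (A : 'M[F]_(m1, n1)) m2 n2 (B : 'M[F]_(m2, n2)) i j :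
  tprod A B i j = A (tfst i) (tfst j) * B (tsnd i) (tsnd j).
Proof.
elim: m1 A i => [|m1 IH] A i /=; first by case: i.
rewrite mxE; case: (split _) => k; last by rewrite IH mxE rshift1.
by rewrite trow_entry !mxE lshift0.
Qed.

Lemma tprod_is_linear m1 n1 (A : 'M[F]_(m1, n1)) m2 n2 :
  linear (@tprod F m1 n1 A m2 n2).
Proof.
by move=> c B D; apply/matrixP=> i j; rewrite !(mxE, tprod_entry) mulrDr mulrCA.
Qed.

HB.instance Definition _ m1 n1 (A : 'M[F]_(m1, n1)) m2 n2 :=
  GRing.isSemilinear.Build F 'M[F]_(m2, n2) 'M[F]_(m1 * m2, n1 * n2) _
    (@tprod F m1 n1 A m2 n2)
    (GRing.semilinear_linear (@tprod_is_linear m1 n1 A m2 n2)).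

(** Flipping the arguments makes linearity in the first factor available as an instance. *)
Definition tprodr m1 n1 m2 n2 (B : 'M[F]_(m2, n2)) (A : 'M[F]_(m1, n1)) :=
  tprod A B.

Lemma tprodr_is_linear m1 n1 m2 n2 (B : 'M[F]_(m2, n2)) :
  linear (@tprodr m1 n1 m2 n2 B).
Proof.
move=> c A D; apply/matrixP=> i j.
by rewrite /tprodr !(mxE, tprod_entry) mulrDl mulrA.
Qed.

HB.instance Definition _ m1 n1 m2 n2 (B : 'M[F]_(m2, n2)) :=
  GRing.isSemilinear.Build F 'M[F]_(m1, n1) 'M[F]_(m1 * m2, n1 * n2) _
    (@tprodr m1 n1 m2 n2 B)
    (GRing.semilinear_linear (@tprodr_is_linear m1 n1 m2 n2 B)).

Lemma trmx_tprod m1 n1 (A : 'M[F]_(m1, n1)) m2 n2 (B : 'M[F]_(m2, n2)) :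
  (tprod A B)^T = tprod A^T B^T.
Proof. by apply/matrixP=> i j; rewrite !(mxE, tprod_entry). Qed.

Lemma map_tprod (f : {rmorphism F -> F}) m1 n1 (A : 'M[F]_(m1, n1))
    m2 n2 (B : 'M[F]_(m2, n2)) :
  map_mx f (tprod A B) = tprod (map_mx f A) (map_mx f B).
Proof. by apply/matrixP=> i j; rewrite !(mxE, tprod_entry) rmorphM. Qed.

Lemma row_free_tprod m1 n1 (A : 'M[F]_(m1, n1)) m2 n2 (B : 'M[F]_(m2, n2)) :
  row_free A -> row_free B -> row_free (tprod A B).
Proof.
case/row_freeP=> A' AA' /row_freeP[B' BB']; apply/row_freeP.
by exists (tprod A' B'); rewrite -tprodE AA' BB' tprod1.
Qed.

End TensorEntries.

(** * Equivariant injections, Maschke averaging, and positivity of virtual representations *)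

Section Embeddings.

Variables (F : fieldType) (gT : finGroupType) (G : {group gT}).
Local Notation reprG := (mx_representation F G).
Local Notation rep := (representation F G).

Definition intertwines n1 n2 (r1 : reprG n1) (r2 : reprG n2)
    (B : 'M[F]_(n1, n2)) :=
  forall g, g \in G -> r1 g *m B = B *m r2 g.

Definition embeds n1 n2 (r1 : reprG n1) (r2 : reprG n2) : Prop :=
  exists2 B : 'M[F]_(n1, n2), row_free B & intertwines r1 r2 B.

Lemma embeds_trans n1 n2 n3 (r1 : reprG n1) (r2 : reprG n2) (r3 : reprG n3) :
  embeds r1 r2 -> embeds r2 r3 -> embeds r1 r3.
Proof.
case=> B fB hB [D fD hD]; exists (B *m D) => [|g Gg].
  by rewrite /row_free mxrankMfree.
by rewrite mulmxA hB // -!mulmxA hD.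
Qed.

(** Phrased through [rdegree] because a product with [grepr0] on the right has degree [n * 0], which
    does not reduce to [0]. *)
Lemma embeds_deg0 (V W : rep) : rdegree V = 0%N -> embeds V W.
Proof.
case: V => n V /= n0; subst n.
exists 0 => [|g _]; first by rewrite /row_free mxrank0.
by rewrite mulmx0 mul0mx.
Qed.

Lemma embeds_prod n1 n2 n3 n4 (r1 : reprG n1) (r2 : reprG n2)
    (r3 : reprG n3) (r4 : reprG n4) :
  embeds r1 r3 -> embeds r2 r4 -> embeds (prod_repr r1 r2) (prod_repr r3 r4).
Proof.
case=> B fB hB [D fD hD]; exists (tprod B D) => [|g Gg].
  exact: row_free_tprod.
by rewrite /= -!tprodE hB // hD.
Qed.

(** Corestriction: the factor [X] with [B = X *m D] is equivariant because [D] can be cancelled on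
    the right. *)
Lemma embeds_factor n1 n2 n3 (r1 : reprG n1) (r2 : reprG n2) (r3 : reprG n3)
    (B : 'M_(n1, n3)) (D : 'M_(n2, n3)) :
  row_free B -> intertwines r1 r3 B -> row_free D -> intertwines r2 r3 D ->
  (B <= D)%MS -> embeds r1 r2.
Proof.
move=> fB hB fD hD /submxP[X defB]; exists X => [|g Gg].
  by rewrite -row_leq_rank -(mxrankMfree X fD) -defB row_leq_rank.
by apply: (row_free_inj fD) => /=; rewrite -!mulmxA hD // -defB hB //
  defB -mulmxA.
Qed.

Lemma embeds_daddl (V W U : rep) : embeds V W -> embeds V (dadd_grepr W U).
Proof.
case=> B /row_freeP[B' BB'] hB; exists (row_mx B 0) => [|g Gg] /=.
  by apply/row_freeP; exists (col_mx B' 0);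
    rewrite mul_row_col BB' mul0mx addr0.
rewrite mul_mx_row hB // mulmx0 mul_row_block !mulmx0 mul0mx.
by rewrite !addr0.
Qed.

Lemma embeds_daddr (V W U : rep) : embeds V W -> embeds V (dadd_grepr U W).
Proof.
case=> B /row_freeP[B' BB'] hB; exists (row_mx 0 B) => [|g Gg] /=.
  by apply/row_freeP; exists (col_mx 0 B');
    rewrite mul_row_col BB' mul0mx add0r.
rewrite mul_mx_row hB // mulmx0 mul_row_block !mulmx0 mul0mx.
by rewrite !add0r.
Qed.

Lemma embeds_add_deg0l (V W U : rep) : rdegree U = 0%N ->
  embeds V W -> embeds (dadd_grepr U V) W.
Proof.
case: U => n U /= n0; subst n.
case=> B fB hB; exists (col_mx 0 B) => [|g Gg] /=.
  by rewrite -row_leq_rank -addsmxE adds0mx row_leq_rank.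
by rewrite mul_block_col hB // mul_col_mx !mul0mx mulmx0 !add0r.
Qed.

Lemma embeds_add_deg0r (V W U : rep) : rdegree U = 0%N ->
  embeds V W -> embeds (dadd_grepr V U) W.
Proof.
case: U => n U /= n0; subst n.
case=> B fB hB; exists (col_mx B 0) => [|g Gg] /=.
  rewrite -row_leq_rank -addsmxE addsmx0 addn0.
  by rewrite row_leq_rank.
by rewrite mul_block_col hB // mul_col_mx !mul0mx mulmx0 !addr0.
Qed.

Lemma mx_rsim_dadd0r (V : rep) : mx_rsim (dadd_grepr V grepr0) V.
Proof.
exists (col_mx 1%:M 0) => [||g Gg] /=; first by rewrite addn0.
  by rewrite -row_leq_rank -addsmxE addsmx0 addn0 mxrank1.
by rewrite mul_block_col mulmx1 mul_col_mx !mul0mx mulmx0 !addr0 mul1mx.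
Qed.

Hypothesis nzG : #|G|%:R != 0 :> F.

Lemma embeds_quotient n1 n2 (r1 : reprG n1) (r2 : reprG n2) B :
  row_full B -> intertwines r1 r2 B -> embeds r2 r1.
Proof.
case/row_fullP=> D DB hB.
(* Average the linear section [D] of [B] over the group: the result is still a section, and it is
   equivariant. *)
pose D' := #|G|%:R^-1 *: \sum_(g in G) r2 g *m D *m r1 g^-1%g.
have hB' g : g \in G -> r1 g^-1%g *m B = B *m r2 g^-1%g.
  by move=> Gg; rewrite hB ?groupV.
exists D'.
  apply/row_freeP; exists B; rewrite -scalemxAl mulmx_suml.
  rewrite (eq_bigr (fun=> 1%:M)) => [|g Gg].
    by rewrite sumr_const -scaler_nat scalerA mulVf // scale1r.
  rewrite -!mulmxA hB' // (mulmxA D) DB mul1mx -repr_mxM ?groupV //.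
  by rewrite mulgV repr_mx1.
move=> h Gh; rewrite -scalemxAr -scalemxAl; congr (_ *: _).
rewrite mulmx_sumr mulmx_suml (reindex_inj (mulgI h^-1%g)) /=.
apply: eq_big => [g|g Gg]; first by rewrite groupMl ?groupV.
have Gg' : g \in G by rewrite groupMl ?groupV in Gg.
rewrite invMg invgK !repr_mxM ?groupV // !mulmxA.
by rewrite -repr_mxM ?groupV // mulgV repr_mx1 mul1mx.
Qed.

Lemma embeds_complement (V W : rep) :
  embeds V W -> exists U : rep, mx_rsim W (dadd_grepr U V).
Proof.
case=> B fB hB; pose U := <<B>>%MS.
have modU : mxmodule W U.
  rewrite (eqmx_module _ (genmxE _)); apply/mxmoduleP=> g Gg.
  by rewrite -hB // submxMl.
have /mx_Maschke_pchar/(_ U modU (submx1 _))[X modX defX dxX] :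
    ([pchar F]^'.-group G)%g.
  by rewrite /pgroup pcharf'_nat.
exists (Representation (submod_repr modX)).
apply: mx_rsim_trans (mx_rsim_sym (rsim_submod1 (mxmodule1 W) _)) _ => //.
apply: (@mx_rsim_dadd _ _ _ _ _ X U _ (Representation _) V modX modU).
- by rewrite addsmxC.
- by apply/mxdirect_addsP; rewrite capmxC; apply/mxdirect_addsP.
- exact: mx_rsim_refl.
apply: mx_rsim_sym; exists (in_submod U B) => [||g Gg].
- by rewrite genmxE (eqP fB).
- by rewrite /row_free mxrank_in_submod ?genmxE.
by rewrite -in_submodJ ?genmxE // -hB // [in RHS]in_submodE in_submodE mulmxA.
Qed.

(** A complement of the negative part inside the positive part represents the difference. *)
Lemma is_rep_embeds (x : vrep F G) : embeds (vneg x) (vpos x) -> is_rep x.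
Proof.
case/embeds_complement=> U sim; exists U, grepr0.
apply: mx_rsim_trans (mx_rsim_dadd0r _) _.
apply: mx_rsim_trans (mx_rsim_dadd0r _) _.
exact: mx_rsim_trans sim (mx_rsim_sym (mx_rsim_dadd0r _)).
Qed.

Lemma vsign_odd p (V : rep) :
  vsign p (vrep_of V) = if odd p then VRep grepr0 V else VRep V grepr0.
Proof.
by elim: p => //= p IH; rewrite /vsign /= -/(vsign p _) IH; case: odd.
Qed.

Lemma is_rep_signed p q r (X Y Z : rep) : odd q = odd r ->
  embeds (prod_repr Y Z) (prod_repr X X) ->
  is_rep (vsub (vmul (vsign p (vrep_of X)) (vsign p (vrep_of X)))
               (vmul (vsign q (vrep_of Y)) (vsign r (vrep_of Z)))).
Proof.
move=> eq_qr YZX; apply: is_rep_embeds; rewrite !vsign_odd -eq_qr.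
have deg0 (V W : rep) : rdegree V = 0%N \/ rdegree W = 0%N ->
    rdegree (prod_grepr V W) = 0%N.
  by move=> /= [] ->; rewrite ?muln0.
have deg0D (V W : rep) : rdegree V = 0%N -> rdegree W = 0%N ->
    rdegree (dadd_grepr V W) = 0%N.
  by move=> /= -> ->.
have YZ : embeds (prod_grepr Y Z) (prod_grepr X X) by [].
rewrite /vsub /vadd /vmul /vopp.
(* In each parity case X (x) X lands in the positive part and Y (x) Z in the negative part; every
   other product has a factor [grepr0], hence degree 0. *)
case: (odd p); case: (odd q); cbn [vpos vneg]; apply: embeds_daddl.
- apply: embeds_daddr; apply: embeds_add_deg0l; first by apply: deg0D; auto.
  by apply: embeds_add_deg0l; auto.
- apply: embeds_daddr; apply: embeds_add_deg0l; first by apply: deg0D; auto.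
  by apply: embeds_add_deg0r; auto.
- apply: embeds_daddl; apply: embeds_add_deg0l; first by apply: deg0D; auto.
  by apply: embeds_add_deg0l; auto.
- apply: embeds_daddl; apply: embeds_add_deg0l; first by apply: deg0D; auto.
  by apply: embeds_add_deg0r; auto.
Qed.

End Embeddings.

(** * Wedge and contraction operators, and the sl_2 relation *)

Section ExteriorOperators.

Variables (F : fieldType) (I : finType).
Implicit Types (A B : {set I}) (a b : I) (P : pred {set I}).

Local Notation ext := 'rV[F]_#|{set I}|.
Local Notation endo := 'M[F]_#|{set I}|.
Local Notation e_ := (ebase F).

Definition espan P : endo := (\sum_(A | P A) <<e_ A>>)%MS.

Lemma espan_coef P m (v : 'M_(m, _)) A i :
  (v <= espan P)%MS -> ~~ P A -> v i (enum_rank A) = 0.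
Proof.
(* Multiplication by [c] reads off the coordinate at [A], which vanishes on every spanning
   vector. *)
move=> sv nPA; pose c : 'cV[F]_#|{set I}| := delta_mx (enum_rank A) 0.
suff: (v *m c <= (0 : 'M_1))%MS.
  by rewrite submx0 -colE => /eqP/matrixP/(_ i 0); rewrite !mxE.
apply: submx_trans (submxMr c sv) _; rewrite /espan sumsmxMr_gen.
apply/sumsmx_subP=> B PB; rewrite genmxE (eqmxMr _ (genmxE _)) submx0.
apply/eqP/matrixP=> j k; rewrite -colE !mxE (inj_eq enum_rank_inj).
case: (eqVneq A B) => [eAB|_]; last by rewrite andbF.
by rewrite eAB PB in nPA.
Qed.

Lemma ebase_espan P A : P A -> (e_ A <= espan P)%MS.
Proof. by move=> PA; rewrite (sumsmx_sup A) ?genmxE. Qed.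

Lemma espan_mulmx P (L : endo) m (M : 'M_(m, _)) :
  (forall A, P A -> e_ A *m L <= M)%MS -> (espan P *m L <= M)%MS.
Proof.
move=> PM; rewrite /espan sumsmxMr; apply/sumsmx_subP=> A PA.
by rewrite (eqmxMr _ (genmxE _)) PM.
Qed.

Lemma edegreeE p : edegree F I p = espan (fun A => #|A| == p).
Proof. by []. Qed.

Lemma endo_ext (L M : endo) : (forall A, e_ A *m L = e_ A *m M) -> L = M.
Proof.
move=> LM; apply/row_matrixP=> i; rewrite !rowE.
by have := LM (enum_val i); rewrite /ebase enum_valK.
Qed.

(* Row vectors are multiplied on the right: [x *m ewedge a] is the wedge      *)
(* product of e_a and x, and [x *m (ewedge a)^T] is the contraction by e_a.   *)
Definition ewedge a : endo := lin1_mx (emul (e_ [set a])).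

Lemma mul_ewedge x a : x *m ewedge a = emul (e_ [set a]) x.
Proof. by rewrite mul_rV_lin1. Qed.

Lemma ebase_ewedge A a : e_ A *m ewedge a =
  if a \in A then 0 else esign F [set a] A *: e_ (a |: A).
Proof. by rewrite mul_ewedge emul_base /emulb disjoints1 if_neg. Qed.

Lemma ebase_ewedgeT A a : e_ A *m (ewedge a)^T =
  if a \in A then esign F [set a] (A :\ a) *: e_ (A :\ a) else 0.
Proof.
apply/rowP=> j; have [B ->] : exists B, j = enum_rank B.
  by exists (enum_val j); rewrite enum_valK.
have -> : (e_ A *m (ewedge a)^T) 0 (enum_rank B) = ecoef A (e_ B *m ewedge a).
  by rewrite /ecoef /ebase -!rowE [LHS]mxE [LHS]mxE [RHS]mxE.
rewrite ebase_ewedge -[LHS]/(ecoef A _) -[RHS]/(ecoef B _).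
have [aB|aB] := boolP (a \in B); have [aA|aA] := boolP (a \in A);
  rewrite ?linear0 // linearZ /= ecoefE.
- have [eB|_] := eqVneq; last by rewrite mulr0.
  by rewrite -eB !inE eqxx in aB.
- rewrite [in RHS]linearZ /= ecoefE; case: eqVneq => [<-|neq].
    by rewrite setU1K // eqxx.
  case: eqVneq => [eB|_]; last by rewrite !mulr0.
  by rewrite -eB setD1K ?eqxx in neq.
- have [eA|_] := eqVneq; last by rewrite mulr0.
  by rewrite -eA !inE eqxx in aA.
Qed.

(** The canonical anticommutation relations. For distinct a and b, the two orders of wedging with
    e_a and contracting by e_b differ by one transposition, hence by a sign. *)
Lemma ewedge_car a b :
  ewedge a *m (ewedge b)^T + (ewedge b)^T *m ewedge a = (a == b)%:R%:M.
Proof.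
apply: endo_ext => A; rewrite mulmxDr !mulmxA ebase_ewedge ebase_ewedgeT.
rewrite mul_mx_scalar; have [<-|nab] := eqVneq a b.
  rewrite scale1r; case: ifP => aA.
    rewrite mul0mx add0r -scalemxAl ebase_ewedge !inE eqxx /=.
    by rewrite scalerA esign_sqr scale1r setD1K.
  rewrite mul0mx addr0 -scalemxAl ebase_ewedgeT !inE eqxx /=.
  by rewrite setU1K ?aA // scalerA esign_sqr scale1r.
rewrite scale0r; case: (boolP (a \in A)) => [aA|aA].
  rewrite mul0mx add0r; case: ifP => bA; last by rewrite mul0mx.
  by rewrite -scalemxAl ebase_ewedge !inE nab aA scaler0.
case: (boolP (b \in A)) => [bA|bA]; last first.
  rewrite mul0mx addr0 -scalemxAl ebase_ewedgeT !inE eq_sym (negPf nab).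
  by rewrite (negPf bA) scaler0.
rewrite -!scalemxAl ebase_ewedgeT ebase_ewedge !inE eq_sym (negPf nab) bA.
rewrite (negPf aA) /=.
have dab: [disjoint [set a] & [set b]] by rewrite disjoints1 inE.
have daA: [disjoint [set a] & A :\ b].
  by rewrite disjoints1 !inE negb_and aA orbT.
have dbA: [disjoint [set b] & A :\ b] by rewrite disjoints1 !inE eqxx.
have ->: (a |: A) :\ b = a |: A :\ b.
  apply/setP=> c; rewrite !inE; case: eqVneq => // ->.
  by rewrite eq_sym (negPf nab).
rewrite !scalerA -scalerDl -{1}(setD1K bA) (esignUr _ _ dbA) (esignUr _ _ daA).
rewrite mulrACA esignC // !cards1 expr1 mulN1r [X in _ + X]mulrC addNr.
by rewrite scale0r.
Qed.

Lemma ewedge_degree p a :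
  (edegree F I p *m ewedge a <= edegree F I p.+1)%MS.
Proof.
rewrite !edegreeE; apply: espan_mulmx => A /eqP cA; rewrite ebase_ewedge.
case: ifP => aA; first exact: sub0mx.
by rewrite scalemx_sub // ebase_espan // cardsU1 aA cA.
Qed.

Lemma ewedgeT_degree p a :
  (edegree F I p.+1 *m (ewedge a)^T <= edegree F I p)%MS.
Proof.
rewrite !edegreeE; apply: espan_mulmx => A /eqP cA; rewrite ebase_ewedgeT.
case: ifP => aA; last exact: sub0mx.
rewrite scalemx_sub // ebase_espan // -eqSS -cA (cardsD1 a A) aA.
by rewrite add1n.
Qed.

(** The number operator: its a-th summand fixes e_A if a is in A and kills it otherwise, so it
    multiplies e_A by #|A|. *)
Definition enumber : endo := \sum_a (ewedge a)^T *m ewedge a.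

Lemma mul_enumber p m (M : 'M_(m, _)) :
  (M <= edegree F I p)%MS -> M *m enumber = p%:R *: M.
Proof.
case/submxP=> X ->; rewrite -mulmxA scalemxAr; congr (_ *m _).
apply/eqP; rewrite -subr_eq0 -mul_mx_scalar -mulmxBr -submx0.
rewrite edegreeE; apply: espan_mulmx => A /eqP cA; rewrite submx0 mulmxBr.
rewrite mul_mx_scalar subr_eq0 /enumber mulmx_sumr; apply/eqP.
rewrite (bigID (mem A)) /= [X in _ + X]big1 ?addr0 => [|a aA].
  rewrite (eq_bigr (fun=> e_ A)) => [|a aA].
    by rewrite sumr_const cA scaler_nat.
  rewrite mulmxA ebase_ewedgeT aA -scalemxAl ebase_ewedge !inE eqxx /=.
  by rewrite scalerA esign_sqr scale1r setD1K.
by rewrite mulmxA ebase_ewedgeT (negPf aA) mul0mx.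
Qed.

Definition eshift := \sum_a tprod (ewedge a)^T (ewedge a).

Lemma eshiftT : eshift^T = \sum_a tprod (ewedge a) (ewedge a)^T.
Proof.
by rewrite linear_sum; apply: eq_bigr => a _; rewrite /= trmx_tprod trmxK.
Qed.

(** Anticommute in both tensor factors: the doubly exchanged terms form the product in the other
    order, and the Kronecker deltas leave a diagonal sum, a difference of number operators. *)
Lemma eshift_commutator :
  eshift *m eshift^T =
    eshift^T *m eshift + (tprod enumber 1%:M - tprod 1%:M enumber).
Proof.
pose X a b := (ewedge b)^T *m ewedge a; pose Y a b := ewedge b *m (ewedge a)^T.
pose D a b : endo := (a == b)%:R%:M.
have carX a b : ewedge a *m (ewedge b)^T = D a b - X a b.
  by rewrite /D /X -ewedge_car addrK.
have carY a b : (ewedge a)^T *m ewedge b = D a b - Y a b.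
  by rewrite /D /Y eq_sym -ewedge_car addrC addKr.
have step a b : tprod (ewedge a)^T (ewedge a) *m tprod (ewedge b) (ewedge b)^T =
    tprod (Y a b) (X a b) +
    (tprod ((ewedge a)^T *m ewedge b) (D a b) - tprod (D a b) (X a b)).
  rewrite -tprodE carX linearB /= addrCA; congr (_ + _).
  by rewrite carY -/(tprodr _ _) linearB /= opprB.
have dsum (f : endo -> I -> 'M[F]_(#|{set I}| * #|{set I}|)) a :
    (forall b, f 0 b = 0) -> \sum_b f (D a b) b = f 1%:M a.
  move=> f0; rewrite (bigD1 a) //= /D eqxx big1 ?addr0 // => b nb.
  by rewrite eq_sym (negPf nb) raddf0 f0.
rewrite eshiftT /eshift.
transitivity (\sum_a \sum_b (tprod (Y a b) (X a b) +
    (tprod ((ewedge a)^T *m ewedge b) (D a b) - tprod (D a b) (X a b)))).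
  rewrite mulmx_suml; apply: eq_bigr => a _.
  by rewrite mulmx_sumr; apply: eq_bigr => b _; apply: step.
under eq_bigr do rewrite big_split.
rewrite big_split exchange_big /=; congr (_ + _).
  rewrite mulmx_suml; apply: eq_bigr => b _; rewrite mulmx_sumr.
  by apply: eq_bigr => a _; rewrite -tprodE.
(* Only the terms with a = b survive in what remains. *)
rewrite -[tprod enumber _]/(tprodr _ _) /enumber [tprodr _ _]linear_sum.
rewrite [tprod _ (\sum_a _)]linear_sum -sumrB /=; apply: eq_bigr => a _.
rewrite sumrB; congr (_ - _).
  rewrite (dsum (fun M b => tprod ((ewedge a)^T *m ewedge b) M)) // => b.
  by rewrite linear0.
rewrite (dsum (fun M b => tprod M (X a b))) // => b.
by rewrite -/(tprodr _ _) linear0.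
Qed.

End ExteriorOperators.

(** * Equivariance of [eshift] *)

Section Equivariance.

Variables (F : fieldType) (I : finType) (gT : finGroupType) (W : {group gT}).
Variable to : action W I.
Implicit Types (A B : {set I}) (a b : I) (g : gT).

Local Notation e_ := (ebase F).
Local Notation E g := (eact F to g).

Lemma ewedge_act g a : ewedge F a *m E g = E g *m ewedge F (to a g).
Proof.
have e_act : e_ [set a] *m E g = e_ [set to a g].
  rewrite ebase_act /asign big_set1 big1 => [|b /andP[/set1P-> ]].
    by rewrite scale1r; congr (ebase F _); apply: imset_set1.
  by rewrite /ltI ltnn.
by apply: endo_ext => A; rewrite !mulmxA !mul_ewedge emulM e_act.
Qed.

Lemma asign_sqr g A : asign F to g A * asign F to g A = 1.
Proof.
rewrite /asign -big_split big1 // => a _ /=.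
by rewrite -big_split big1 // => b _ /=; rewrite -expr2 sqrr_sign.
Qed.

(** The group acts by signed permutation matrices. Orthogonality lets equivariance of the wedge be
    transposed into equivariance of the contraction. *)
Lemma eact_orthogonal g : E g *m (E g)^T = 1%:M.
Proof.
have tI : injective (to^*%act^~ g) by apply: act_inj.
apply: endo_ext => A; rewrite mulmxA ebase_act -scalemxAl mulmx1.
apply/rowP=> j; have [B ->] : exists B, j = enum_rank B.
  by exists (enum_val j); rewrite enum_valK.
rewrite mxE; set D := to^*%act A g.
have -> : (e_ D *m (E g)^T) 0 (enum_rank B) = ecoef D (e_ B *m E g).
  by rewrite /ecoef /ebase -!rowE [LHS]mxE [LHS]mxE [RHS]mxE.
rewrite ebase_act linearZ /= ecoefE (inj_eq tI) -[RHS]/(ecoef B _) ecoefE.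
by rewrite eq_sym; case: eqP => [->|_]; rewrite ?mulr0 // mulr1 asign_sqr.
Qed.

Lemma ewedgeT_act g a : (ewedge F a)^T *m E g = E g *m (ewedge F (to a g))^T.
Proof.
have EtE : (E g)^T *m E g = 1%:M by apply: mulmx1C; apply: eact_orthogonal.
have /(congr1 trmx) := ewedge_act g a; rewrite !trmx_mul => eq_aT.
rewrite -[LHS]mul1mx -(eact_orthogonal g) -mulmxA (mulmxA (E g)^T) eq_aT.
by rewrite -[X in _ *m X]mulmxA EtE mulmx1.
Qed.

Lemma eshift_act : let r := prod_repr (ext_repr F to) (ext_repr F to) in
  intertwines r r (eshift F I).
Proof.
move=> /= g _; rewrite /eshift mulmx_sumr mulmx_suml.
(* g only permutes the summands of [eshift]. *)
rewrite (reindex_inj (act_inj to g)); apply: eq_bigr => a _.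
by rewrite -!tprodE -ewedge_act -ewedgeT_act.
Qed.

End Equivariance.

(** * Hermitian norm and injectivity of [eshift] *)

Section Positivity.

Variables (C : numClosedFieldType) (I : finType).

Definition sqnorm n (v : 'rV[C]_n) : C := \sum_i `|v 0 i| ^+ 2.

Lemma sqnormE n (v : 'rV[C]_n) : (v *m (map_mx Num.conj v)^T) 0 0 = sqnorm v.
Proof. by rewrite mxE; apply: eq_bigr => i _; rewrite !mxE normCK. Qed.

Lemma sqnorm_ge0 n (v : 'rV[C]_n) : 0 <= sqnorm v.
Proof. by apply: sumr_ge0 => i _; rewrite exprn_ge0. Qed.

Lemma sqnorm_eq0 n (v : 'rV[C]_n) : sqnorm v = 0 -> v = 0.
Proof.
move=> v0; apply/rowP=> i; rewrite mxE.
have /psumr_eq0P/(_ v0)/(_ i isT)/eqP :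
    forall j : 'I_n, true -> 0 <= `|v 0 j| ^+ 2.
  by move=> j _; rewrite exprn_ge0.
by rewrite expf_eq0 normr_eq0 => /eqP.
Qed.

Lemma esign_conj (A B : {set I}) : (esign C A B)^* = esign C A B.
Proof.
rewrite /esign rmorph_prod; apply: eq_bigr => a _.
by rewrite rmorph_prod; apply: eq_bigr => b _; rewrite rmorph_sign.
Qed.

(** The entries are 0 or signs, so the transpose is the Hermitian adjoint. *)
Lemma ewedge_conj (a : I) : map_mx Num.conj (ewedge C a) = ewedge C a.
Proof.
have conj_base (A : {set I}) : map_mx Num.conj (ebase C A) = ebase C A.
  exact: map_delta_mx.
apply: endo_ext => A; rewrite -[in LHS]conj_base -map_mxM ebase_ewedge.
case: ifP => _; first by rewrite map_mx0.
by rewrite map_mxZ /= esign_conj conj_base.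
Qed.

Lemma eshift_conj : map_mx Num.conj (eshift C I) = eshift C I.
Proof.
rewrite /eshift raddf_sum; apply: eq_bigr => a _ /=.
by rewrite map_tprod -map_trmx ewedge_conj.
Qed.

(** [M1] and [M2] serve as bases of L_{p+2} and L_p inside the exterior algebra. The commutator is
    the scalar (p + 2) - p = 2 there, so v T = 0 forces a sum of two nonnegative terms, one of them
    twice the squared norm of v, to vanish. *)
Lemma eshift_free p m1 m2 (M1 : 'M_(m1, _)) (M2 : 'M_(m2, _)) :
  row_free M1 -> row_free M2 ->
  (M1 <= edegree C I p.+2)%MS -> (M2 <= edegree C I p)%MS ->
  row_free (tprod M1 M2 *m eshift C I).
Proof.
move=> free1 free2 deg1 deg2; apply: inj_row_free => u; rewrite mulmxA.
set v := u *m tprod M1 M2; set T := eshift C I => vT0.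
have v_comm :
    v *m (tprod (enumber C I) 1%:M - tprod 1%:M (enumber C I)) = 2%:R *: v.
  rewrite mulmxBr -!mulmxA -!tprodE !mulmx1.
  rewrite (mul_enumber deg1) (mul_enumber deg2).
  rewrite [tprod M1 (_ *: _)]linearZ -[tprod (_ *: _) M2]/(tprodr M2 _).
  rewrite [tprodr _ _]linearZ /= -!scalemxAr -scalerBl.
  by rewrite -natrB ?leqW // -addn2 addKn.
have shift0 : v *m T^T *m T + 2%:R *: v = 0.
  by rewrite -v_comm -mulmxA -mulmxDr -eshift_commutator mulmxA vT0 mul0mx.
(* Pair [shift0] with the conjugate of [v]; T being real, its first term gives the squared norm of
   [v *m T^T]. *)
have /eqP : sqnorm (v *m T^T) + 2%:R * sqnorm v = 0.
  transitivity (((v *m T^T *m T + 2%:R *: v) *m (map_mx Num.conj v)^T) 0 0).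
    rewrite mulmxDl mxE -scalemxAl [X in _ = _ + X]mxE -!sqnormE.
    by rewrite map_mxM trmx_mul -map_trmx trmxK eshift_conj !mulmxA.
  by rewrite shift0 mul0mx mxE.
rewrite paddr_eq0 ?mulr_ge0 ?sqnorm_ge0 ?ler0n //.
case/andP=> _; rewrite mulf_eq0 pnatr_eq0 /= => /eqP/sqnorm_eq0 v0.
apply: (row_free_inj (row_free_tprod free1 free2)) => /=.
by rewrite mul0mx.
Qed.

End Positivity.

(** * The embedding between products of exterior powers *)

Section ExteriorPowers.

Variables (C : numClosedFieldType) (I : finType).
Variables (gT : finGroupType) (W : {group gT}) (to : action W I).

Definition ext_power p := submod_repr (edegree_module C to p).

Lemma val_submod_intertwines n (r : mx_representation C W n) (U : 'M_n)
  (modU : mxmodule r U) : intertwines (submod_repr modU) r (val_submod 1%:M).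
Proof.
by move=> g Gg; rewrite -val_submodE -[X in val_submod X]mul1mx val_submodJ.
Qed.

Lemma ext_power_log_concave p :
  embeds (prod_repr (ext_power p.+2) (ext_power p))
         (prod_repr (ext_power p.+1) (ext_power p.+1)).
Proof.
pose R q : 'M_(_, _) := val_submod (U := edegree C I q) 1%:M.
have freeR q : row_free (R q) by rewrite /row_free val_submod1.
have subR q : (R q <= edegree C I q)%MS by apply: val_submodP.
have hR q : intertwines (ext_power q) (ext_repr C to) (R q).
  exact: val_submod_intertwines.
have hRR q r : intertwines (prod_repr (ext_power q) (ext_power r))
    (prod_repr (ext_repr C to) (ext_repr C to)) (tprod (R q) (R r)).
  by move=> g Gg /=; rewrite -!tprodE hR // hR.
apply: (embeds_factor (B := tprod (R p.+2) (R p) *m eshift C I)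
                      (D := tprod (R p.+1) (R p.+1))).
- exact: eshift_free.
- by move=> g Gg; rewrite mulmxA hRR // -!mulmxA eshift_act.
- exact: row_free_tprod.
- exact: hRR.
(* Each summand of [eshift] maps bidegree (p + 2, p) into bidegree (p + 1, p + 1). *)
rewrite /eshift mulmx_sumr; apply: summx_sub => a _; rewrite -tprodE.
have [X ->] : exists X, R p.+2 *m (ewedge C a)^T = X *m R p.+1.
  apply/submxP; rewrite val_submod1 (submx_trans (submxMr _ (subR p.+2))) //.
  exact: ewedgeT_degree.
have [Y ->] : exists Y, R p *m ewedge C a = Y *m R p.+1.
  apply/submxP; rewrite val_submod1 (submx_trans (submxMr _ (subR p))) //.
  exact: ewedge_degree.
by rewrite tprodE submxMl.
Qed.

End ExteriorPowers.

(** * A submodule V compared with its image in the quotient by U *)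

Section Sections.

Variables (F : fieldType) (gT : finGroupType) (G : {group gT}) (n : nat).
Variables (r : mx_representation F G n) (U V : 'M[F]_n).
Variables (modU : mxmodule r U) (modV : mxmodule r V).

Let Q := <<in_factmod U V>>%MS.
(** The quotient map restricted to V, in the coordinates of [submod_repr] and [section_repr]. It is
    always onto, and it is injective when V meets U trivially. *)
Let B := in_submod Q (in_factmod U (val_submod (U := V) 1%:M)).

Let sub_factor m (X : 'M_(m, n)) : (X <= V)%MS -> (in_factmod U X <= Q)%MS.
Proof.
move=> sXV; rewrite genmxE in_factmodE [X in (_ <= X)%MS]in_factmodE.
exact: submxMr.
Qed.

Let mulB m (X : 'M_(m, _)) :
  X *m B = in_submod Q (in_factmod U (val_submod X)).
Proof. by rewrite /B /in_submod /in_factmod /val_submod /= !mulmxA mulmx1. Qed.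

Let B_hom : intertwines (submod_repr modV) (section_repr modU modV) B.
Proof.
move=> g Gg; rewrite -in_submodJ ?sub_factor ?val_submodP // -in_factmodJ //.
rewrite -(val_submodJ modV 1%:M Gg) mul1mx.
exact: mulB.
Qed.

Lemma section_embeds : (V :&: U)%MS = 0 ->
  embeds (submod_repr modV) (section_repr modU modV).
Proof.
move=> VU0; exists B => //; apply: inj_row_free => u.
rewrite mulB => /eqP; rewrite -val_submod_eq0.
rewrite in_submodK ?sub_factor ?val_submodP //.
rewrite in_factmod_eq0 => suU; apply/eqP.
by rewrite -val_submod_eq0 -submx0 -VU0 sub_capmx val_submodP.
Qed.

Lemma embeds_section : #|G|%:R != 0 :> F ->
  embeds (section_repr modU modV) (submod_repr modV).
Proof.
move=> nzG; apply: (embeds_quotient nzG) B_hom.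
rewrite /row_full mxrank_in_submod ?sub_factor ?val_submodP //.
by rewrite in_factmodE (eqmxMr _ (val_submod1 V)) -in_factmodE genmxE.
Qed.

End Sections.

(** * The Orlik-Solomon ideal of the uniform matroid lives in degrees at least d *)

Section UniformIdeal.

Variables (F : fieldType) (m d : nat).
Local Notation I := 'I_(m + d).
Implicit Types A B : {set I}.

Local Notation high := (espan F (fun A : {set I} => d <= #|A|)%N).

Lemma emul_high A (x : 'rV_#|{set I}|) : (x <= high)%MS ->
  (emul (ebase F A) x <= high)%MS /\ (emul x (ebase F A) <= high)%MS.
Proof.
have stable (f : {linear 'rV[F]_#|{set I}| -> 'rV[F]_#|{set I}|}) :
    (forall B, (d <= #|B|)%N -> f (ebase F B) <= high)%MS ->
    (x <= high)%MS -> (f x <= high)%MS.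
  move=> fB sx; rewrite -(mul_rV_lin1 f); apply: submx_trans (submxMr _ sx) _.
  by apply: espan_mulmx => B dB; rewrite mul_rV_lin1 fB.
have emulb_high B (D : {set I}) :
    (d <= #|B|)%N || (d <= #|D|)%N -> (emulb F B D <= high)%MS.
  move=> dBD; rewrite /emulb; case: ifP => _; last exact: sub0mx.
  apply/scalemx_sub/ebase_espan.
  by case/orP: dBD => /leq_trans; apply;
    rewrite subset_leq_card ?subsetUl ?subsetUr.
move=> sx; split.
  by apply: stable sx => B dB; rewrite /= emul_base emulb_high ?dB ?orbT.
rewrite -/(emulr _ _); apply: stable sx => B dB.
by rewrite /= /emulr emul_base emulb_high ?dB.
Qed.

(** A circuit is dependent, so it has more than d elements and its derivative has degree at least d;
    multiplication does not lower degrees. *)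
Lemma os_ideal_uniform : (os_ideal F (uniform m d) <= high)%MS.
Proof.
apply/sumsmx_subP=> K /minsetP[/= depK _].
apply/sumsmx_subP=> A _; apply/sumsmx_subP=> B _; rewrite genmxE.
apply: (emul_high _ _).2; apply: (emul_high _ _).1.
rewrite ederiv_base; apply: summx_sub => a Ka; apply/scalemx_sub/ebase_espan.
by move: depK; rewrite !inE -ltnNge (cardsD1 a K) Ka.
Qed.

Lemma edegree_os_ideal p : (p < d)%N ->
  (edegree F I p :&: os_ideal F (uniform m d))%MS = 0.
Proof.
move=> ltpd; set K := (_ :&: _)%MS; apply/matrixP=> i j; rewrite mxE.
have [A ->] : exists A, j = enum_rank A.
  by exists (enum_val j); rewrite enum_valK.
(* No basis vector e_A is common to both spans: #|A| = p excludes d <= #|A|. *)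
have [dA|/negP dA] := boolP (d <= #|A|)%N.
  apply: (@espan_coef F I (fun A => #|A| == p)); first exact: capmxSl.
  by rewrite neq_ltn (leq_trans ltpd) ?orbT.
apply: (@espan_coef F I (fun A : {set I} => d <= #|A|)%N); last exact/negP.
exact: submx_trans (capmxSr _ _) os_ideal_uniform.
Qed.

End UniformIdeal.

(** * From exterior powers to Orlik-Solomon algebras and to the polynomial *)

Lemma os_repr_log_concave (C : numClosedFieldType) m d p : (p.+1 < d)%N ->
  let os := os_repr C (@uniform_acts m d) in
  embeds (prod_repr (os p.+2) (os p)) (prod_repr (os p.+1) (os p.+1)).
Proof.
move=> ltpd os.
have nzG : #|[set: 'S_(m + d)]|%:R != 0 :> C.
  by rewrite pnatr_eq0 -lt0n cardG_gt0.
apply: embeds_trans (embeds_trans (ext_power_log_concave C _ p) _).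
  by apply: embeds_prod; apply: embeds_section.
by apply: embeds_prod; apply: section_embeds; apply: edegree_os_ideal.
Qed.

Theorem proposition5p7 (R : realType) (m d : nat) :
  log_concave (uniform_char_poly R[i] m d).
Proof.
move=> i i_gt0; pose os := os_repr R[i] (@uniform_acts m d).
have nzS : #|[set: 'S_(m + d)]|%:R != 0 :> R[i].
  by rewrite pnatr_eq0 -lt0n cardG_gt0.
have coef_le k : (k <= d)%N -> coefv (uniform_char_poly R[i] m d) k =
    vsign (d - k) (vrep_of (os (d - k)%N)).
  move=> le_kd; rewrite /coefv /uniform_char_poly /equiv_char_poly.
  by rewrite mrank_uniform nth_mkseq.
(* Past the degree the coefficient is 0, which may be given any sign [q]. *)
have coef_gt k q : (d < k)%N -> coefv (uniform_char_poly R[i] m d) k =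
    vsign q (vrep_of grepr0).
  move=> lt_dk; rewrite /coefv /uniform_char_poly /equiv_char_poly.
  by rewrite mrank_uniform nth_default ?size_mkseq // vsign_odd if_same.
have [le_di | lt_id] := leqP d i.
  have coef_sign k : exists q V,
      coefv (uniform_char_poly R[i] m d) k = vsign q (vrep_of V).
    have [/coef_le-> | /(coef_gt _ 0%N)->] := leqP k d;
      by do 2!eexists; reflexivity.
  have [[p [X ->]] [q [Y ->]]] := (coef_sign i, coef_sign i.-1).
  (* Give the zero coefficient at i + 1 the sign of the one at i - 1, as [is_rep_signed] requires
     equal parities. *)
  rewrite (coef_gt i.+1 q) //; apply: (is_rep_signed nzS) => //.
  exact: (embeds_deg0 (V := prod_grepr Y grepr0) (prod_grepr X X) (muln0 _)).
rewrite !coef_le ?(ltnW lt_id) ?(leq_trans (leq_pred i) (ltnW lt_id)) //.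
(* From here p = d - i - 1, so the three degrees are p + 1, p + 2 and p. *)
have di : (d - i = (d - i.+1).+1)%N by rewrite -subSn // subSS.
have di' : (d - i.-1 = (d - i.+1).+2)%N.
  by rewrite -di -subSn ?(ltnW lt_id) // -{2}(prednK i_gt0) subSS.
rewrite di' di; apply: (is_rep_signed nzS); first by rewrite /= negbK.
apply: os_repr_log_concave.
(* The bound p + 1 < d amounts to d - i < d, which uses i > 0. *)
by rewrite -di ltn_subrL i_gt0 (leq_trans i_gt0 (ltnW lt_id)).
Qed.
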